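(* Let $G$ be a finite group. Let $Q$ be a $2$-subgroup of $G$ and $K$ a $2'$-subgroup of $G$. Suppose that all Sylow $2$-subgroups of $N_{G}(Q)$ are contained in $N_{G}(K)$. Then $QK$ is a perfect code of $G$ if and only if $Q$ is a perfect code of $G$. In particular, if $Q$ is a $2$-subgroup of $G$ and $K$ is a normal $2'$-subgroup of $G$, then $QK$ is a perfect code of $G$ if and only if $Q$ is a perfect code of $G$.
   Context: For a finite group $G$ with identity $1$ and a subset $S\subseteq G\setminus\{1\}$ with $S^{-1}=S$ (possibly $S=\emptyset$), the Cayley graph $\mathrm{Cay}(G,S)$ has vertex set $G$, with $x,y$ adjacent if and only if $yx^{-1}\in S$. A perfect code in a graph $\Gamma$ with vertex set $V$ is a subset $C\subseteq V$ such that no two vertices of $C$ are adjacent and every vertex in $V\setminus C$ is adjacent to exactly one vertex in $C$. A subset (in particular a subgroup) $C$ of $G$ is called a perfect code of $G$ if there exists such an $S$ for which $C$ is a perfect code in $\mathrm{Cay}(G,S)$. A $2$-subgroup is a subgroup whose order is a power of $2$; a $2'$-subgroup is a subgroup of odd order. $N_G(X)$ denotes the normalizer of $X$ in $G$, and $QK=\{qk: q\in Q, k\in K\}$. *)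

(* Defs.v *)
From mathcomp Require Import all_boot all_fingroup all_solvable.

Set Implicit Arguments.
Unset Strict Implicit.
Unset Printing Implicit Defensive.

Import GroupScope.

(* A graph is given by a vertex set V inside a finite type and an adjacency
   relation e, which only matters on V. *)
Definition perfect_code (T : finType) (V : {set T}) (e : rel T) (C : {set T}) :
    Prop :=
  [/\ C \subset V,
      {in C &, forall x y, ~~ e x y}
    & {in V :\: C, forall v, #|[set c in C | e v c]| = 1%N}].

(* S^-1 is the pointwise inverse of the set S; S may be empty. *)
Definition connection_set (gT : finGroupType) (G S : {set gT}) : Prop :=
  S \subset G :\ 1 /\ S^-1 = S.

Definition cayley_adj (gT : finGroupType) (S : {set gT}) : rel gT :=
  fun x y => y * x^-1 \in S.

Definition perfect_code_of (gT : finGroupType) (G C : {set gT}) : Prop :=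
  exists2 S : {set gT}, connection_set G S & perfect_code G (cayley_adj S) C.

(* Main.v *)
Require Import Defs.
From mathcomp Require Import all_boot all_fingroup all_solvable.

Import GroupScope.

(** More is true: a subgroup H of G is a perfect code of G if and only if any
    Sylow 2-subgroup Q of H is one ([Sylow_perfect_code]). Under either set of
    hypotheses Q normalizes K: either K is normal in G, or Q lies in some Sylow
    2-subgroup of N_G(Q), which normalizes K. So QK is a group, with Sylow
    2-subgroup Q because K has odd order.

    A subgroup H is a perfect code of G exactly when it has an inverse-closed
    left transversal T containing 1, the connection set being T minus 1. On a
    double coset HgH that differs from its inverse such a T is easy to choose,
    and on one that is its own inverse the obstruction is a parity: a left and
    a right coset of H inside HgH always meet, so distinct left cosets xH and yH
    in HgH can be served by one pair t, t^-1; a single left over coset needs an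
    element with t^2 = 1. Hence the criterion [perfect_code_involution]: if
    g^2 lies in H and |H : H^g| is odd, then gH contains some t with t^2 = 1.

    This criterion passes between H and Q. If it holds for Q, and g is as in
    the criterion for H, then a Sylow 2-subgroup P of L = H :&: H^g is Sylow in
    H and, by the Frattini argument, some f in gL normalizes it; the 2-part b of
    f is still in gH, and b^2 is a 2-element of N_H(P), hence in P, so the
    criterion for P, a conjugate of Q, applies to b. Conversely, if it holds
    for H and g normalizes Q with g^2 in Q, there is an x in gH with x^2 = 1,
    and a conjugate y of x by an element of L normalizes Q and stays in gH. So
    g^-1 y is in N_H(Q), which has odd order modulo Q: the images of g and y in
    N_G(Q) / Q generate a dihedral group of twice odd order, in which they are
    conjugate, and a conjugate of y lies in gQ. *)

Set Implicit Arguments.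
Unset Strict Implicit.
Unset Printing Implicit Defensive.

(** * Perfect codes and inverse-closed transversals *)

Definition left_separated (gT : finGroupType) (H T : {set gT}) : bool :=
  [forall s in T, forall t in T, (s^-1 * t \in H) ==> (s == t)].

(** An inverse-closed partial left transversal of H in G; it contains 1 so that
    the coset H itself is represented by 1 and T minus 1 avoids H. *)
Definition symmetric_packing (gT : finGroupType) (G H T : {set gT}) : bool :=
  [&& T \subset G, 1 \in T, T^-1 == T & left_separated H T].

Lemma left_separatedP (gT : finGroupType) (H T : {set gT}) :
  reflect {in T &, forall s t, s^-1 * t \in H -> s = t} (left_separated H T).
Proof.
apply: (iffP forall_inP) => [sepT s t Ts Tt Hst | sepT s Ts].
  by apply/eqP; apply: (implyP (forall_inP (sepT s Ts) t Tt)).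
by apply/forall_inP=> t Tt; apply/implyP=> Hst; apply/eqP/sepT.
Qed.

Lemma memV_sym (gT : finGroupType) (A : {set gT}) (x : gT) :
  A^-1 = A -> (x^-1 \in A) = (x \in A).
Proof. by move=> symA; rewrite -mem_invg symA. Qed.

Lemma sym_eqP (gT : finGroupType) (A : {set gT}) :
  (forall x, x \in A -> x^-1 \in A) -> A^-1 = A.
Proof.
move=> symA; apply/setP=> x; rewrite mem_invg.
by apply/idP/idP=> /symA //; rewrite invgK.
Qed.

(** As S is inverse-closed, v and c are adjacent when v c^-1 is in S, so that the
    neighbours of v in H correspond to the elements of S in the left coset vH:
    a connection set for which H is a perfect code is a system of representatives
    of the left cosets other than H. *)
Lemma perfect_code_transversal (gT : finGroupType) (G H : {group gT}) :
  H \subset G ->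
  perfect_code_of G H <->
  exists2 T : {set gT}, symmetric_packing G H T & G \subset T * H.
Proof.
move=> sHG; split=> [[S [sSG symS] [_ indH codeH]] | [T]].
  have S_G s : s \in S -> s \in G by move/(subsetP sSG); rewrite !inE => /andP[].
  have S_H s : s \in S -> s \notin H.
    move=> Ss; apply/negP=> Hs; move: (indH 1 s (group1 H) Hs).
    by rewrite /cayley_adj invg1 mulg1 Ss.
  exists (1 |: S).
    apply/and4P; split.
    - by apply/subsetP=> s; rewrite !inE => /predU1P[-> | /S_G].
    - by rewrite !inE eqxx.
    - apply/eqP/sym_eqP=> s; rewrite !inE => /predU1P[-> | Ss].
        by rewrite invg1 eqxx.
      by rewrite (memV_sym _ symS) Ss orbT.
    apply/left_separatedP=> s t Ts Tt Hst; have [Hs | nHs] := boolP (s \in H).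
      have Ht : t \in H by rewrite -(mulKVg s t) groupM.
      move: Ts Tt; rewrite !inE => /predU1P[-> | /S_H/negP//].
      by case/predU1P=> [-> // | /S_H/negP].
    have Ss : s \in S.
      by move: Ts nHs; rewrite !inE => /predU1P[-> | //]; rewrite group1.
    have nHt : t \notin H.
      by apply: contra nHs => Ht; rewrite -groupV -(groupMr _ Ht).
    have St : t \in S.
      by move: Tt nHt; rewrite !inE => /predU1P[-> | //]; rewrite group1.
    have /codeH/eqP/cards1P[c def_c] : s \in G :\: H by rewrite inE nHs S_G.
    (* s and t = s h give the neighbours 1 and h^-1 of s in H. *)
    have : 1 \in [set c].
      by rewrite -def_c inE group1 /cayley_adj mul1g memV_sym.
    have eq_c: t^-1 * s \in [set c].
      rewrite -def_c inE /cayley_adj mulgK memV_sym // St andbT.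
      by rewrite -groupV invMg invgK.
    move: eq_c; rewrite !inE => /eqP<- /eqP t's1.
    by apply/esym/eqP; rewrite eq_mulVg1 -t's1.
  apply/subsetP=> x Gx; have [Hx | nHx] := boolP (x \in H).
    by rewrite -(mul1g x) mem_mulg // !inE eqxx.
  have /codeH/eqP/cards1P[c def_c] : x \in G :\: H by rewrite inE nHx.
  have : c \in [set c] by rewrite inE.
  rewrite -def_c inE /cayley_adj => /andP[Hc Scx].
  rewrite -(mulgKV c x) mem_mulg // !inE.
  by rewrite -(memV_sym _ symS) invMg invgK Scx orbT.
case/and4P=> sTG T1 /eqP symT /left_separatedP sepT coverT.
exists (T :\ 1).
  split; first exact: setSD.
  apply: sym_eqP => s; rewrite !inE (memV_sym _ symT) => /andP[nt_s ->].
  by rewrite invg_eq1 nt_s.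
split=> // [x y Hx Hy | v /setDP[Gv nHv]].
  rewrite /cayley_adj !inE negb_and negbK orbC.
  have [Tyx /= | //] := boolP (_ \in T); apply/eqP/esym/sepT => //.
  by rewrite invg1 mul1g groupM ?groupV.
have /mulsgP[t h Tt Hh def_v] := subsetP coverT v Gv.
apply/eqP/cards1P; exists h; apply/setP=> c; rewrite !inE /cayley_adj.
apply/idP/eqP=> [/andP[Hc /setD1P[_ Tcv]] | ->].
  rewrite -(memV_sym _ symT) invMg invgK in Tcv.
  have def_t : t = v * c^-1.
    by apply: sepT; rewrite // def_v -mulgA mulKg groupM ?groupV.
  by apply: (mulgI t); rewrite -def_v def_t mulgKV.
rewrite Hh def_v invMg mulKVg in_setD1 (memV_sym _ symT) Tt andbT invg_eq1.
by apply: contraNneq nHv => t1; rewrite def_v t1 mul1g.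
Qed.

(** Inversion is an involution of A, and its orbits of length 2 use up an even
    number of elements. *)
Lemma odd_symmetric_fixed (gT : finGroupType) (A : {set gT}) :
  A^-1 = A -> odd #|A| -> exists2 t, t \in A & t^-1 = t.
Proof.
have [n] := ubnP #|A|; elim: n A => // n IHn A ltAn symA oddA.
have /card_gt0P[a Aa]: 0 < #|A| by case: #|A| oddA.
have [aa | neq_a] := eqVneq a^-1 a; first by exists a.
have Aa' : a^-1 \in A :\ a by rewrite !inE neq_a memV_sym.
have cardA : #|A| = #|A :\ a :\ a^-1|.+2 by rewrite (cardsD1 a) Aa
    (cardsD1 a^-1) Aa'.
have [||| t] := IHn (A :\ a :\ a^-1).
- by rewrite cardA in ltAn; apply: ltnW.
- apply: sym_eqP => x; rewrite !inE (memV_sym _ symA) (inj_eq invg_inj).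
  by rewrite -[a in x^-1 == a]invgK (inj_eq invg_inj) => /and3P[-> -> ->].
- by rewrite cardA /= negbK in oddA.
by rewrite !inE => /and3P[_ _ At] fix_t; exists t.
Qed.

Lemma card_left_separated_mul (gT : finGroupType) (H : {group gT}) (T : {set gT}) :
  left_separated H T -> #|T * H| = (#|T| * #|H|)%N.
Proof.
move/left_separatedP=> sepT; rewrite -cardsX.
have -> : T * H = [set s * h | s in T, h in H] by [].
rewrite curry_imset2X.
apply: card_in_imset => -[s h] [t k] /setXP[/= Ts Hh] /setXP[/= Tt Hk] eq_sh.
have eq_st : s = t.
  apply: sepT => //; have -> : t = s * h * k^-1 by rewrite eq_sh mulgK.
  by rewrite -mulgA mulKg groupM ?groupV.
by congr pair => //; apply: (mulgI s); rewrite eq_sh eq_st.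
Qed.

(** * Double cosets *)

Lemma card_double_coset (gT : finGroupType) (H : {group gT}) (g : gT) :
  #|H :* g * H| = (#|H : H :^ g| * #|H|)%N.
Proof.
have -> : H :* g * H = g *: (H :^ g * H).
  by rewrite conjsgE -!mulgA lcosetKV.
rewrite card_lcoset; apply/eqP.
rewrite -(eqn_pmul2r (cardG_gt0 (H :&: H :^ g))) mulnAC (mulnC #|H : _|).
by rewrite LagrangeI /= [H :&: _]setIC -mul_cardG cardJg.
Qed.

(** The parity condition on self-inverse double cosets: HgH is its own inverse
    exactly when it contains some g with g^2 in H, and it then consists of
    |H : H^g| left cosets, all containing an involution (or 1) as soon as one
    does, since they are permuted by conjugation under H. *)
Definition involution_condition (gT : finGroupType) (G H : {set gT}) : Prop :=
  forall g, g \in G -> g ^+ 2 \in H -> odd #|H : H :^ g| ->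
  exists2 h, h \in H & (g * h) ^+ 2 = 1.

Lemma dcosetP (gT : finGroupType) (H : {group gT}) (x y : gT) :
  reflect (exists h k, [/\ h \in H, k \in H & y = h * x * k])
          (y \in H :* x * H).
Proof.
apply: (iffP mulsgP) => [[_ k /rcosetP[h Hh ->] Hk ->] | [h [k [Hh Hk ->]]]].
  by exists h, k.
by exists (h * x) k; rewrite // mem_rcoset mulgK.
Qed.

Lemma dcoset_inv (gT : finGroupType) (H : {group gT}) (x : gT) :
  (H :* x * H)^-1 = H :* x^-1 * H.
Proof. by rewrite !invMg invGid invg_set1 mulgA. Qed.

Lemma dcoset_eq (gT : finGroupType) (H : {group gT}) (x y : gT) :
  y \in H :* x * H -> H :* y * H = H :* x * H.
Proof.
case/dcosetP=> h [k [Hh Hk ->]].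
by rewrite !rcosetM (rcoset_id Hh) -[_ * H]mulgA lcoset_id.
Qed.

Lemma dcoset_refl (gT : finGroupType) (H : {group gT}) (x : gT) :
  x \in H :* x * H.
Proof. by apply/dcosetP; exists 1, 1; rewrite group1 mul1g mulg1. Qed.

Lemma dcoset_sym (gT : finGroupType) (H : {group gT}) (g : gT) :
  g ^+ 2 \in H -> (H :* g * H)^-1 = H :* g * H.
Proof.
move=> Hg2; rewrite dcoset_inv; apply/dcoset_eq/dcosetP.
exists 1, (g ^+ 2)^-1; rewrite group1 groupV Hg2 mul1g expgS expg1 invMg.
by rewrite mulKVg.
Qed.

(** A left coset in HxH and a right coset in HxH always meet; here the right
    coset is the set of inverses of yH. *)
Lemma dcoset_meet (gT : finGroupType) (H : {group gT}) (x y : gT) :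
  y \in H :* x^-1 * H -> exists2 t, t \in x *: H & t^-1 \in y *: H.
Proof.
case/dcosetP=> h [k [Hh Hk ->]]; exists (x * h^-1).
  by rewrite mem_lcoset mulKg groupV.
by apply/lcosetP; exists k^-1; rewrite ?groupV // invMg invgK mulgK.
Qed.

Lemma dcosetMr (gT : finGroupType) (H : {group gT}) (x y k : gT) :
  k \in H -> (y * k \in H :* x * H) = (y \in H :* x * H).
Proof.
have Dmul z h : h \in H -> z \in H :* x * H -> z * h \in H :* x * H.
  by move=> Hh Dz; have := mem_mulg Dz Hh; rewrite -mulgA mulGid.
move=> Hk; apply/idP/idP=> [|/Dmul->//].
by move/(Dmul _ k^-1); rewrite mulgK groupV => ->.
Qed.

Lemma packing_dcosetE (gT : finGroupType) (H : {group gT}) (T : {set gT}) x :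
  (T :&: (H :* x * H)) * H = (T * H) :&: (H :* x * H).
Proof.
apply/setP=> y; apply/mulsgP/setIP=> [[t h /setIP[Tt Dt] Hh ->] | [THy Dy]].
  split; first exact: mem_mulg.
  by rewrite dcosetMr.
case/mulsgP: THy Dy => t h Tt Hh -> Dth; exists t h => //.
by rewrite dcosetMr // in Dth; rewrite inE Tt.
Qed.

Lemma card_packing_dcoset (gT : finGroupType) (H : {group gT}) (T : {set gT}) x :
  left_separated H T ->
  #|(T * H) :&: (H :* x * H)| = (#|T :&: (H :* x * H)%g| * #|H|)%N.
Proof.
move/left_separatedP=> sepT; rewrite -packing_dcosetE card_left_separated_mul //.
by apply/left_separatedP=> s t /setIP[Ts _] /setIP[Tt _]; apply: sepT.
Qed.

(** * The involution criterion *)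

(** The part of T inside a self-inverse double coset is closed under inversion
    and has one element per left coset, so an odd number of cosets forces a fixed
    point t of inversion; its conjugate by H lies in gH. *)
Lemma transversal_involution (gT : finGroupType) (G H : {group gT}) T :
  H \subset G -> symmetric_packing G H T -> G \subset T * H ->
  involution_condition G H.
Proof.
move=> sHG /and4P[sTG T1 /eqP symT sepT] coverT g Gg Hg2 odd_g.
set D := H :* g * H.
have sDG : D \subset G by rewrite !mul_subG // sub1set.
have symD : D^-1 = D by apply: dcoset_sym.
have cardTD : #|T :&: D| = #|H : H :^ g|.
  apply/eqP; rewrite -(eqn_pmul2r (cardG_gt0 H)) -card_packing_dcoset //.
  by rewrite (setIidPr (subset_trans sDG coverT)) card_double_coset.
have [||t /setIP[_ Dt] tV] := @odd_symmetric_fixed _ (T :&: D).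
- by apply: sym_eqP => x; rewrite !in_setI (memV_sym _ symT) (memV_sym _ symD).
- by rewrite cardTD.
case/dcosetP: Dt tV => h [k [Hh Hk ->]] tV; exists (k * h); first exact: groupM.
have -> : g * (k * h) = (h * g * k) ^ h by rewrite conjgE -!mulgA mulKg.
by rewrite -conjXg expgS expg1 -{1}tV mulVg conj1g.
Qed.

(** The elementary enlargement of a packing: two unused cosets tH and t^-1H are
    represented by t and t^-1; they may coincide only if t is its own inverse. *)
Lemma packing_extend (gT : finGroupType) (G H : {group gT}) T (t : gT) :
  symmetric_packing G H T -> t \in G -> t \notin T * H -> t^-1 \notin T * H ->
  (t^-1 * t^-1 \in H -> t^-1 = t) ->
  symmetric_packing G H (t |: (t^-1 |: T))
  /\ #|t |: (t^-1 |: T)| = (#|T| + (t^-1 != t)).+1%N.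
Proof.
case/and4P=> sTG T1 /eqP symT /left_separatedP sepT Gt nTt nTt' fix_t.
have sTTH : T \subset T * H := mulG_subl H T.
have new u v : u \in T -> v \notin T * H -> u^-1 * v \in H -> u = v.
  move=> Tu /negP nTv Huv; case: nTv.
  by rewrite -(mulKVg u v) mem_mulg.
have new' u v : u \in T -> v \notin T * H -> v^-1 * u \in H -> v = u.
  by move=> Tu nTv Hvu; apply/esym/new; rewrite // -groupV invMg invgK.
have fix_t' : t * t \in H -> t^-1 = t.
  by move=> Htt; apply: fix_t; rewrite -invMg groupV.
split; last first.
  rewrite !cardsU1 !inE negb_or (contra (subsetP sTTH t) nTt).
  by rewrite (contra (subsetP sTTH _) nTt') andbT add1n addnS addnC eq_sym.
apply/and4P; split.
- by apply/subsetP=> u; rewrite !inE => /or3P[/eqP->|/eqP->|];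
    rewrite ?groupV // => /(subsetP sTG).
- by rewrite !inE T1 !orbT.
- apply/eqP/sym_eqP=> u; rewrite !inE => /or3P[/eqP->|/eqP->|Tu].
  + by rewrite eqxx orbT.
  + by rewrite invgK eqxx.
  + by rewrite (memV_sym _ symT) Tu !orbT.
apply/left_separatedP=> u v; rewrite !inE.
case/or3P=> [/eqP->|/eqP->|Tu]; case/or3P=> [/eqP->|/eqP->|Tv] //.
- by move/fix_t.
- exact: new'.
- by rewrite invgK => /fix_t'.
- exact: new'.
- exact: new.
- exact: new.
- exact: sepT.
Qed.

(** A packing T of maximal size meets every coset. If xH is not met, then,
    as T has equally many elements in HxH and in its inverse, the inverse of HxH
    has an unmet coset as well, and by maximality each such coset is xH. So HxH is
    its own inverse and xH is its only unmet coset. If the number of cosets in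
    HxH is odd, xH contains an element that is its own inverse, which could be
    added to T. If it is even, T has an odd number of elements in HxH, hence
    one z with z^-1 = z; replacing z by some t in xH and t^-1 in zH enlarges T. *)
Lemma involution_transversal (gT : finGroupType) (G H : {group gT}) :
  H \subset G -> involution_condition G H ->
  exists2 T : {set gT}, symmetric_packing G H T & G \subset T * H.
Proof.
move=> sHG involH.
have pack1 : symmetric_packing G H 1.
  rewrite /symmetric_packing sub1G group1 invg1 eqxx.
  by apply/left_separatedP=> s t /set1P-> /set1P->.
case: (arg_maxnP (fun T : {set gT} => #|T|) pack1) => T packT maxT.
exists T => //; apply/subsetP=> x Gx; apply: contraT => nTx.
have [sTG T1 /eqP symT sepT] := and4P packT.
have inG y z : y \in G -> z \in y *: H -> z \in G.
  by move=> Gy /lcosetP[h /(subsetP sHG) Gh ->]; rewrite groupM.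
have nTd y z : y \notin T * H -> z \in y *: H -> z \notin T * H.
  move=> nTy /lcosetP[h Hh ->]; apply: contra nTy => /mulsgP[t k Tt Hk yh].
  by rewrite -(mulgK h y) yh -mulgA mem_mulg // groupM ?groupV.
have noext t : t \in x *: H -> t^-1 \notin T * H ->
    (t^-1 * t^-1 \in H -> t^-1 = t) -> False.
  move=> xt nTt' fix_t; have nTt := nTd _ _ nTx xt.
  have [packT' cardT'] := packing_extend packT (inG _ _ Gx xt) nTt nTt' fix_t.
  by have := maxT _ packT'; rewrite /= cardT' /geq /= ltnNge leq_addr.
set D := H :* x * H.
have Dx : x \in D by apply: dcoset_refl.
have sq_t y : y \in D^-1 -> y \notin T * H ->
    exists t, [/\ t \in x *: H, y \in t *: H & t ^+ 2 \in H].
  rewrite dcoset_inv => /dcoset_meet[t xt yt'] nTy; exists t.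
  have Htt : t^-1 * t^-1 \in H.
    apply: contraT => /negP nHtt.
    by case: (noext t xt (nTd _ _ nTy yt')) => /nHtt.
  split=> //; last by rewrite -groupV expgS expg1 invMg.
  by rewrite lcoset_sym in yt'; apply: lcoset_trans yt' _; rewrite mem_lcoset.
have cardTD : #|T * H :&: D| = (#|T :&: D| * #|H|)%N by apply: card_packing_dcoset.
have [y Dy nTy] : exists2 y, y \in D^-1 & y \notin T * H.
  apply/subsetPn/negP => sD'T.
  (* T covers equally many elements of D and of D^-1, but not x in D. *)
  have: #|T * H :&: D| < #|D|.
    apply: proper_card; rewrite properE subsetIr /=.
    by apply/subsetPn; exists x; rewrite // inE negb_and nTx.
  rewrite cardTD -(card_invg (T :&: D)) invIg symT -(card_invg D).
  rewrite dcoset_inv -card_packing_dcoset // -dcoset_inv.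
  by rewrite (setIidPr sD'T) ltnn.
have [t [xt ty Htt]] := sq_t y Dy nTy.
have nTt := nTd _ _ nTx xt.
have Gt : t \in G := inG _ _ Gx xt.
have Dt : t \in D by case/lcosetP: xt => h Hh ->; rewrite dcosetMr.
have symD : D^-1 = D.
  by rewrite /D -(dcoset_eq Dt) dcoset_sym.
have [odd_t | even_t] := boolP (odd #|H : H :^ t|).
  have [h Hh th2] := involH t Gt Htt odd_t.
  have fix_th : (t * h)^-1 = t * h.
    by apply/eqP; rewrite eq_invg_mul -th2 expgS expg1.
  have tth : t * h \in t *: H by rewrite mem_lcoset mulKg.
  case: (noext (t * h)) => //; rewrite ?fix_th.
    exact: lcoset_trans xt.
  exact: nTd tth.
have defDT : D :\: T * H = t *: H.
  apply/eqP; rewrite eqEsubset; apply/andP; split; apply/subsetP=> z.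
    case/setDP; rewrite -symD => Dz nTz; have [s [xs sz _]] := sq_t z Dz nTz.
    by apply: lcoset_trans sz (lcoset_trans xs _); rewrite lcoset_sym.
  move=> tz; rewrite inE (nTd _ _ nTt tz).
  by case/lcosetP: tz => h Hh ->; rewrite dcosetMr.
have oddTD : odd #|T :&: D|.
  have /eqP := cardsID (T * H) D; rewrite setIC cardTD defDT card_lcoset.
  have -> : #|D| = (#|H : H :^ t| * #|H|)%N.
    by rewrite -card_double_coset (dcoset_eq Dt).
  rewrite -mulSnr eqn_pmul2r // => /eqP cardD.
  by rewrite -cardD /= negbK in even_t.
have [|z /setIP[Tz Dz] zV] := @odd_symmetric_fixed _ (T :&: D) _ oddTD.
  by rewrite invIg symT symD.
(* The element z is traded for a pair that represents both zH and xH. *)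
have nzx : z \notin x *: H.
  by apply: contra nTx; rewrite lcoset_sym => /lcosetP[h Hh ->]; rewrite mem_mulg.
have nt_z : 1 != z.
  apply: contraNneq nTx => z1; rewrite -z1 in Dz.
  move: Dx; rewrite /D -(dcoset_eq Dz) mulg1 mulGid => Hx.
  by rewrite -(mul1g x) mem_mulg.
have packT0 : symmetric_packing G H (T :\ z).
  apply/and4P; split.
  - exact: subset_trans (subD1set T z) sTG.
  - by rewrite !inE nt_z.
  - apply/eqP/sym_eqP=> s; rewrite !inE (memV_sym _ symT) => /andP[nzs ->].
    by rewrite -[z]zV (inj_eq invg_inj) nzs.
  apply/left_separatedP=> s u /setD1P[_ Ts] /setD1P[_ Tu].
  exact: (left_separatedP _ _ sepT).
have [s xs zs'] : exists2 s, s \in x *: H & s^-1 \in z *: H.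
  by apply: dcoset_meet; rewrite -dcoset_inv -/D symD.
have nT0s : s \notin (T :\ z) * H.
  by apply: contra (nTd _ _ nTx xs); apply/subsetP/mulSg/subD1set.
have nT0s' : s^-1 \notin (T :\ z) * H.
  apply/mulsgP=> -[u h /setD1P[neq_uz Tu] Hh def_s'].
  case/eqP: neq_uz; apply/esym/(left_separatedP _ _ sepT) => //.
  by move: zs'; rewrite mem_lcoset def_s' mulgA groupMr.
have nss' : s^-1 \notin s *: H.
  apply: contra nzx => ss'; rewrite lcoset_sym in zs'.
  exact: lcoset_trans zs' (lcoset_trans ss' xs).
have [|packT' cardT'] := packing_extend packT0 (inG _ _ Gx xs) nT0s nT0s'.
  by rewrite -mem_lcoset => ss'; rewrite ss' in nss'.
have := maxT _ packT'; rewrite /= cardT' /geq /= [#|T|](cardsD1 z) Tz.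
have -> : s^-1 != s.
  by apply: contraNneq nss' => ->; apply: lcoset_refl.
by rewrite addn1 add1n ltnn.
Qed.

Lemma perfect_code_involution (gT : finGroupType) (G H : {group gT}) :
  H \subset G -> perfect_code_of G H <-> involution_condition G H.
Proof.
move=> sHG; split=> [/(perfect_code_transversal sHG)[T packT coverT] | involH].
  exact: transversal_involution packT coverT.
exact/(perfect_code_transversal sHG)/involution_transversal.
Qed.

(** * Transfer to a Sylow 2-subgroup *)

Lemma odd_double_half (gT : finGroupType) (v : gT) :
  odd #[v] -> v ^+ #[v].+1./2.*2 = v.
Proof. by move=> odd_v; rewrite even_halfK /= ?odd_v // expgSr expg_order mul1g. Qed.

(** Two involutions generate a dihedral group; when their product v has odd order
    they are conjugate, by a square root of v among its powers. *)
Lemma involution_conj_odd (gT : finGroupType) (u v : gT) :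
  u ^+ 2 = 1 -> (u * v) ^+ 2 = 1 -> odd #[v] -> exists i, u ^ (v ^+ i) = u * v.
Proof.
move=> u2 uv2 odd_v; exists #[v].+1./2.
have uV : u^-1 = u by apply/eqP; rewrite eq_invg_mul -u2 expgS expg1.
have uvV : (u * v)^-1 = u * v by apply/eqP; rewrite eq_invg_mul -uv2 expgS expg1.
set w := v ^+ _; have wV : w^-1 = u * w * u^-1.
  have vu : v ^ u = v^-1 by rewrite conjgE uV mulgA -uvV invMg mulgKV.
  by rewrite -expgVn -vu -conjXg conjgE {1}uV mulgA uV.
rewrite conjgE wV -!mulgA mulKg; congr (u * _).
by rewrite -expgD addnn odd_double_half.
Qed.

Lemma Sylow_odd_index (gT : finGroupType) (H L P : {group gT}) :
  L \subset H -> odd #|H : L| -> 2.-Sylow(L) P -> 2.-Sylow(H) P.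
Proof.
move=> sLH odd_HL /and3P[sPL pP oddLP]; rewrite /pHall (subset_trans sPL) // pP.
by rewrite -(Lagrange_index sLH sPL) pnatM oddLP -odd_2'nat odd_HL.
Qed.

Lemma normal_meet_conj (gT : finGroupType) (H : {group gT}) (g : gT) :
  g ^+ 2 \in H -> g \in 'N(H :&: H :^ g).
Proof.
move=> Hg2; rewrite inE conjIg -conjsgM -[g * g]/(g ^+ 2) (conjGid Hg2).
by rewrite setIC.
Qed.

(** Every g in the criterion for H can be moved, inside gH, to a 2-element that
    normalizes a Sylow 2-subgroup P of H. *)
Lemma Sylow_involution_condition_up (gT : finGroupType) (G H Q : {group gT}) :
  H \subset G -> 2.-Sylow(H) Q ->
  involution_condition G Q -> involution_condition G H.
Proof.
move=> sHG sylQ involQ g Gg Hg2 odd_g.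
pose L := (H :&: H :^ g)%G.
have sLH : L \subset H := subsetIl _ _.
have nLg : g \in 'N(L) := normal_meet_conj Hg2.
have [P sylP] := Sylow_exists 2 L.
have sylP_H : 2.-Sylow(H) P.
  by apply: Sylow_odd_index sylP; rewrite // indexgI.
have [l Ll Pgl] : exists2 l, l \in L & P :^ g = P :^ l.
  have sylPg : 2.-Sylow(L) (P :^ g)%G by rewrite pHallJnorm.
  by have [l Ll] := Sylow_trans sylP sylPg; exists l.
(* Frattini argument: f normalizes P and stays in gH. *)
pose f := g * l^-1.
have Hl : l \in H := subsetP sLH l Ll.
have nPf : f \in 'N(P) by apply/normP; rewrite conjsgM Pgl conjsgK.
have Hf2 : f ^+ 2 \in H.
  have -> : f ^+ 2 = g ^+ 2 * (l^-1 ^ g * l^-1).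
    by rewrite conjgE expgS expg1 /f !mulgA mulgK.
  rewrite groupM // (subsetP sLH) // groupM ?groupV //.
  by rewrite memJ_norm ?groupV.
(* The 2'-part a of f is a power of f^2, so it is in H, and b = f a^-1 is in gH. *)
pose b := f.`_2; pose a := f.`_2^'.
have Hconstt pi : f.`_pi ^+ 2 \in H.
  by rewrite -consttX; apply: subsetP (cycle_constt _ _); rewrite cycle_subG.
have Ha : a \in H.
  have odd_a : odd #[a] by rewrite odd_2'nat; apply: p_elt_constt.
  rewrite -(odd_double_half odd_a).
  by rewrite -mul2n expgM groupX ?Hconstt.
have Gf : f \in G by rewrite groupM ?groupV // (subsetP sHG).
have Gb : b \in G by apply: groupX.
have nPb : b \in 'N(P) by apply: groupX.
have Pb2 : b ^+ 2 \in P.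
  have sylN : 2.-Sylow('N_H(P)) P by rewrite Sylow_subnorm.
  rewrite (mem_normal_Hall sylN); first by rewrite -consttX p_elt_constt.
    by rewrite normalSG // (pHall_sub sylP_H).
  by rewrite inE Hconstt groupX.
have [k Hk defQ] := Sylow_trans sylP_H sylQ.
have nQb : Q :^ (b ^ k) = Q.
  by rewrite defQ -conjsgM -conjgC conjsgM (normP nPb).
have [|||q Qq bq2] := involQ (b ^ k).
- by rewrite groupJ // (subsetP sHG).
- by rewrite -conjXg defQ memJ_conjg.
- by rewrite nQb indexgg.
have {}bq2 : (b * q ^ k^-1) ^+ 2 = 1.
  by rewrite -[b](conjgK k) -conjMg -conjXg bq2 conj1g.
exists (l^-1 * a^-1 * q ^ k^-1).
  by rewrite !(groupM, groupJ, groupV) // (subsetP (pHall_sub sylQ)).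
suff -> : g * (l^-1 * a^-1 * q ^ k^-1) = b * q ^ k^-1 by [].
by rewrite !mulgA -/f -{1}(consttC 2 f) mulgK.
Qed.

(** Modulo Q, g and y are involutions (or 1) with product in N_H(Q) / Q, a group
    of odd order, hence they are conjugate; lifting the conjugation turns y into an
    element of gQ. *)
Lemma involution_in_normalized_coset (gT : finGroupType) (H Q : {group gT}) (g y : gT) :
  2.-Sylow(H) Q -> g \in 'N(Q) -> y \in 'N(Q) ->
  g ^+ 2 \in Q -> y ^+ 2 = 1 -> g^-1 * y \in H ->
  exists2 q, q \in Q & (g * q) ^+ 2 = 1.
Proof.
move=> sylQ nQg nQy Qg2 y2 Hn; set n := g^-1 * y in Hn.
have nQn : n \in 'N(Q) by rewrite groupM ?groupV.
have def_y : y = g * n by rewrite mulKVg.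
have [||| i] := @involution_conj_odd _ (coset Q g) (coset Q n).
- by rewrite -morphX //= coset_id.
- by rewrite -morphM // -def_y -morphX //= y2 coset_id.
- have oddNQ : odd #|'N_H(Q) / Q|.
    rewrite card_quotient ?subsetIr // odd_2'nat.
    by have := sylQ; rewrite -Sylow_subnorm => /and3P[].
  apply: dvdn_odd oddNQ; apply: order_dvdG; apply: mem_quotient.
  by rewrite inE Hn.
rewrite -morphX // -morphJ ?groupX // -morphM // -def_y /= => /esym/eqP.
rewrite -[_ == _](sameP (rcoset_kercosetP _ _) eqP) ?groupJ ?groupX //.
case/rcosetP=> q Qq.
set c := n ^+ i => def_yc; have nQc : c \in 'N(Q) by rewrite groupX.
have Qq' : q ^ c^-1 \in Q by rewrite memJ_norm ?groupV.
exists ((q ^ c^-1) ^ g); first by rewrite memJ_norm.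
by rewrite -conjgC -[g](conjgK c) -conjMg -def_yc -conjXg y2 conj1g.
Qed.

(** For the 2-group Q, an odd index |Q : Q^g| means that g normalizes Q, and then
    Q is a Sylow 2-subgroup of L = H :&: H^g. The criterion for H gives an
    involution x in gH; being a 2-element, x normalizes a Sylow 2-subgroup P of
    H :&: H^x, and P also turns out to be Sylow in L, so that it is conjugate to
    Q by some l in L. As g normalizes L, the conjugate of x by l^-1 remains in
    gH. *)
Lemma Sylow_involution_condition_down (gT : finGroupType) (G H Q : {group gT}) :
  H \subset G -> 2.-Sylow(H) Q ->
  involution_condition G H -> involution_condition G Q.
Proof.
move=> sHG sylQ involH g Gg Qg2 odd_g.
have [sQH pQ oddHQ] := and3P sylQ.
have nQg : Q :^ g = Q.
  have sQQg : Q \subset Q :^ g.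
    rewrite -indexg_eq1; apply/eqP/(@pnat_1 2); last by rewrite -odd_2'nat.
    exact: pnat_dvd (dvdn_indexg _ _) pQ.
  by apply/esym/eqP; rewrite eqEcard sQQg cardJg leqnn.
have Hg2 : g ^+ 2 \in H := subsetP sQH _ Qg2.
pose L := (H :&: H :^ g)%G.
have sLH : L \subset H := subsetIl _ _.
have sQL : Q \subset L by rewrite subsetI sQH -{1}nQg conjSg.
have odd_Hg : odd #|H : H :^ g|.
  rewrite -indexgI; apply: (@dvdn_odd _ #|H : Q|); last by rewrite odd_2'nat.
  by rewrite -(Lagrange_index sLH sQL) dvdn_mulr.
have [h Hh x2] := involH g Gg Hg2 odd_Hg; set x := g * h in x2.
pose M := (H :&: H :^ x)%G.
have sMH : M \subset H := subsetIl _ _.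
have nMx : x \in 'N(M) by apply: normal_meet_conj; rewrite x2.
have [P [sylP nPx]] : exists P : {group gT}, 2.-Sylow(M) P /\ x \in 'N(P).
  have px : 2.-group <[x]>.
    by apply: pnat_dvd (_ : 2.-nat 2); rewrite // order_dvdn x2.
  have [R sylR sxR] := Sylow_superset (joing_subr M <[x]>) px.
  exists (M :&: R)%G; split.
    by apply: Sylow_setI_normal sylR; rewrite normalYl cycle_subG.
  rewrite -cycle_subG normsI ?cycle_subG //.
  by rewrite -cycle_subG (subset_trans sxR) ?normG.
have sylP_H : 2.-Sylow(H) P.
  apply: Sylow_odd_index sylP; rewrite // indexgI /= /x conjsgM.
  by rewrite -{1}(conjGid Hh) indexJg.
have sPL : P \subset L.
  (* P = P^x = P^(gh), so P^g is in H; and H^(g^-1) = H^g as g^2 is in H. *)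
  have HgV : H :^ g = H :^ g^-1.
    by rewrite -{2}(conjGid Hg2) -conjsgM expgS expg1 mulgK.
  rewrite subsetI (pHall_sub sylP_H) /= HgV -sub_conjg.
  have -> : g = x * h^-1 by rewrite mulgK.
  by rewrite conjsgM (normP nPx) conj_subG ?groupV ?(pHall_sub sylP_H).
have [l Ll defP] := Sylow_trans (pHall_subl sQL sLH sylQ) (pHall_subl sPL sLH sylP_H).
have Hl := subsetP sLH l Ll.
apply: (@involution_in_normalized_coset _ H Q g (x ^ l^-1)) => //.
- exact/normP.
- by rewrite -(conjsgK l Q) -defP normJ memJ_conjg.
- by rewrite -conjXg x2 conj1g.
have -> : g^-1 * x ^ l^-1 = l ^ g * h * l^-1.
  by rewrite !conjgE invgK /x !mulgA.
have Llg : l ^ g \in L by rewrite memJ_norm //; apply: normal_meet_conj.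
rewrite -mulgA; apply: groupM (subsetP sLH _ Llg) _.
by rewrite groupM ?groupV.
Qed.

(** * Perfect codes and Sylow 2-subgroups *)

Lemma Sylow_perfect_code (gT : finGroupType) (G H Q : {group gT}) :
  H \subset G -> 2.-Sylow(H) Q ->
  perfect_code_of G H <-> perfect_code_of G Q.
Proof.
move=> sHG sylQ; have sQG := subset_trans (pHall_sub sylQ) sHG.
split=> [/(perfect_code_involution sHG) | /(perfect_code_involution sQG)] involG.
  exact/(perfect_code_involution sQG)/(Sylow_involution_condition_down sHG sylQ).
exact/(perfect_code_involution sHG)/(Sylow_involution_condition_up sHG sylQ).
Qed.

Theorem theorem4p3 (gT : finGroupType) (G : {group gT}) :
  (forall Q K : {group gT},
     Q \subset G -> 2.-group Q ->
     K \subset G -> odd #|K| ->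
     (forall P : {group gT}, P \in 'Syl_2('N_G(Q)) -> P \subset 'N_G(K)) ->
     perfect_code_of G (Q * K) <-> perfect_code_of G Q)
  /\
  (forall Q K : {group gT},
     Q \subset G -> 2.-group Q ->
     K <| G -> odd #|K| ->
     perfect_code_of G (Q * K) <-> perfect_code_of G Q).
Proof.
have codeQK (Q K : {group gT}) : Q \subset G -> 2.-group Q -> K \subset G ->
    odd #|K| -> Q \subset 'N(K) -> perfect_code_of G (Q * K) <-> perfect_code_of G Q.
  move=> sQG pQ sKG oddK nKQ; rewrite -norm_joinEl //.
  apply: Sylow_perfect_code; first by rewrite join_subG sQG.
  rewrite /pHall joing_subl pQ /= -odd_2'nat; apply: dvdn_odd oddK.
  by rewrite norm_joinEl // indexMg dvdn_indexg.
split=> Q K sQG pQ.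
  move=> sKG oddK nKP; apply: codeQK => //.
  have sQN : Q \subset 'N_G(Q) by rewrite subsetI sQG normG.
  have [P sylP sQP] := Sylow_superset sQN pQ.
  apply: subset_trans sQP (subset_trans (nKP P _) (subsetIr _ _)).
  by rewrite inE.
case/andP=> sKG nKG oddK; apply: codeQK => //; exact: subset_trans nKG.
Qed.
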